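(* Let $A$ be an $n\times n$ alternating sign matrix. Then $\partial(\Phi(A))=\kappa(A)$.
   Context: An alternating sign matrix (ASM) is a square matrix with entries in $\{-1,0,1\}$ such that in each row and column the nonzero entries alternate in sign and sum to $1$. An ASM with no negative entries is a permutation matrix, identified with the permutation $w$ such that the $1$'s are in positions $(i,w(i))$. Bumpless pipe dreams. Cells $(i,j)$ of the $n\times n$ grid: row $i$ from the top, column $j$ from the left. There are six tiles: downward elbow (a pipe joining the bottom and right edges), upward elbow (a pipe joining the left and top edges), crossing (one pipe joining left and right edges and one joining bottom and top edges), blank (no pipe), horizontal (left to right), vertical (bottom to top). A bumpless pipe dream (BPD) of size $n$ is a tiling of the grid by these tiles such that an edge shared by two cells is met by a pipe from both sides or from neither, every bottom and right boundary edge is met by a pipe, and no left or top boundary edge is met by a pipe. $\Phi$ is the bijection from $n\times n$ ASMs to BPDs of size $n$ for which $\Phi(A)$ has a downward elbow exactly where $A_{ij}=1$ and an upward elbow exactly where $A_{ij}=-1$. Explicitly, a pipe meets the right edge of cell $(i,j)$ iff $\sum_{k\le j}A_{ik}=1$, and meets the bottom edge of $(i,j)$ iff $\sum_{k\le i}A_{kj}=1$. Demazure product $\partial(\mathcal P)\in S_n$ of a BPD: label the bottom boundary edges $1,\dots,n$ from left to right and propagate labels along pipes north and east; at a crossing tile, of the two labels entering from the left and from below, the smaller leaves through the right edge and the larger through the top edge. $\partial(\mathcal P)(i)$ is the label arriving at the right boundary edge of row $i$. Inflation and key. The pivots of $(a,b)$ in $A$ are the positions $(i,j)\ne(a,b)$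 with $i\le a$, $j\le b$, $A_{ij}=1$, such that the only nonzero entries of $A$ in $[i,a]\times[j,b]$ are $A_{ij}$ and possibly $A_{ab}$. Suppose $A_{ab}=-1$ and let its pivots be $(i_1,j_1),\dots,(i_k,j_k)$ with $i_1<\cdots<i_k$ and $j_1>\cdots>j_k$. $A_{ab}$ is a removable $-1$ if there are no negative entries other than $A_{ab}$ in $\bigcup_{\ell=1}^{k-1}[i_\ell,a]\times[j_{\ell+1},b]$. Inflation of a removable $-1$ at $(a,b)$ sets the entries at $(a,b)$ and at all its pivots to $0$ and places $1$'s in positions $(i_1,j_2),(i_2,j_3),\dots,(i_{k-1},j_k)$; the result is an ASM with one fewer negative entry. The key $\kappa(A)$ is the permutation obtained by repeatedly applying inflation to the leftmost $-1$ in the topmost row containing negative entries (which is always removable), until no negative entries remain. *)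

(* Defs.v *)
From mathcomp Require Import all_boot all_order all_fingroup all_algebra.

Set Implicit Arguments.
Unset Strict Implicit.
Unset Printing Implicit Defensive.

Import Order.TTheory GRing.Theory Num.Theory.
Local Open Scope ring_scope.

(** * Alternating sign matrices *)

Definition asm_line (s : seq int) : bool :=
  [&& all (mem [:: -1; 0; 1 : int]) s,
      sorted (fun x y : int => x * y < 0) [seq x <- s | x != 0]
    & \sum_(x <- s) x == 1].

Definition is_asm (n : nat) (A : 'M[int]_n) : bool :=
  [forall i, asm_line [seq A i j | j : 'I_n]] &&
  [forall j, asm_line [seq A i j | i : 'I_n]].

Record asm (n : nat) := ASM { asm_mx :> 'M[int]_n; asmP : is_asm asm_mx }.

(** * Bumpless pipe dreams *)

Inductive tile :=
  DownElbow | UpElbow | Crossing | Blank | Horizontal | Vertical.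

Definition meets_left (t : tile) : bool :=
  match t with UpElbow | Crossing | Horizontal => true | _ => false end.
Definition meets_right (t : tile) : bool :=
  match t with DownElbow | Crossing | Horizontal => true | _ => false end.
Definition meets_top (t : tile) : bool :=
  match t with UpElbow | Crossing | Vertical => true | _ => false end.
Definition meets_bottom (t : tile) : bool :=
  match t with DownElbow | Crossing | Vertical => true | _ => false end.

Record is_bpd (n : nat) (P : 'I_n -> 'I_n -> tile) : Prop := IsBPD {
  bpd_inner_v : forall i j j' : 'I_n, j' = j.+1 :> nat ->
    meets_right (P i j) = meets_left (P i j');
  bpd_inner_h : forall i i' j : 'I_n, i' = i.+1 :> nat ->
    meets_bottom (P i j) = meets_top (P i' j);
  bpd_right : forall i j : 'I_n, j.+1 = n :> nat -> meets_right (P i j);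
  bpd_bottom : forall i j : 'I_n, i.+1 = n :> nat -> meets_bottom (P i j);
  bpd_left : forall i j : 'I_n, j = 0%N :> nat -> ~~ meets_left (P i j);
  bpd_top : forall i j : 'I_n, i = 0%N :> nat -> ~~ meets_top (P i j) }.

Record bpd (n : nat) :=
  BPD { bpd_tile :> 'I_n -> 'I_n -> tile; bpdP : is_bpd bpd_tile }.

(** * From alternating sign matrices to bumpless pipe dreams *)

Definition right_edge (n : nat) (A : 'M[int]_n) (i j : 'I_n) : bool :=
  \sum_(k < n | (k <= j)%N) A i k == 1.
Definition bottom_edge (n : nat) (A : 'M[int]_n) (i j : 'I_n) : bool :=
  \sum_(k < n | (k <= i)%N) A k j == 1.

Definition Phi_tile (n : nat) (A : 'M[int]_n) (i j : 'I_n) : tile :=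
  if A i j == 1 then DownElbow
  else if A i j == -1 then UpElbow
  else match right_edge A i j, bottom_edge A i j with
       | true, true => Crossing
       | true, false => Horizontal
       | false, true => Vertical
       | false, false => Blank
       end.

Lemma asm_line_take s k : asm_line s ->
  (\sum_(x <- take k s) x == 0) || (\sum_(x <- take k s) x == 1).
Proof.
case/and3P=> s_in s_alt /eqP s_sum.
pose h t := head 0 [seq x <- t | x != 0 :> int].
have key t m : all (mem [:: -1; 0; 1 : int]) t ->
    sorted (fun x y : int => x * y < 0) [seq x <- t | x != 0] ->
    (\sum_(x <- take m t) x == 0) || (\sum_(x <- take m t) x == h t).
  elim: t m => [|x t IHt] [|m] //=; rewrite ?big_nil //.
  case/andP=> x_in t_in; rewrite big_cons /h /=.
  have [-> /=|x_nz /=] := eqVneq x 0; first by rewrite add0r => /(IHt m t_in).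
  move=> t_path; have t_alt := path_sorted t_path.
  case/orP: (IHt m t_in t_alt) => /eqP ->; first by rewrite addr0 eqxx orbT.
  rewrite /h; move: t_path; case E: [seq _ <- t | _] => [|y u] /=.
    by rewrite addr0 eqxx orbT.
  case/andP=> xy _.
  have: y \in t.
    have: y \in [seq x <- t | x != 0] by rewrite E mem_head.
    by rewrite mem_filter => /andP[].
  move/(allP t_in) => y_in; move: x_nz xy.
  have: x \in [:: -1; 0; 1 : int] := x_in.
  have: y \in [:: -1; 0; 1 : int] := y_in.
  by rewrite !inE => /or3P[] /eqP-> /or3P[] /eqP->.
have := key s (size s) s_in s_alt; rewrite take_size s_sum oner_eq0 /=.
by move/eqP=> h1; have := key s k s_in s_alt; rewrite -h1.
Qed.

Lemma asm_line_sum (n : nat) (f : 'I_n -> int) (p : nat) :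
    asm_line [seq f k | k : 'I_n] ->
  (\sum_(k < n | (k < p)%N) f k == 0) || (\sum_(k < n | (k < p)%N) f k == 1).
Proof.
move/(asm_line_take p); rewrite -map_take big_map.
suff ->: take p (enum 'I_n) = [seq k : 'I_n <- enum 'I_n | (k < p)%N].
  by rewrite big_filter big_enum_cond.
apply: (inj_map val_inj); rewrite map_take val_enum_ord.
rewrite -(filter_map val (fun k => (k < p)%N)) val_enum_ord.
have [pn|np] := leqP p n.
  rewrite take_iota (minn_idPl pn) -[in RHS](subnKC pn) iotaD filter_cat add0n.
  rewrite (@eq_in_filter _ _ predT (iota 0 p)) ?filter_predT; last first.
    by move=> k; rewrite mem_iota.
  rewrite (@eq_in_filter _ _ pred0 (iota p _)) ?filter_pred0 ?cats0 //.
  by move=> k; rewrite mem_iota leqNgt => /andP[/negbTE-> _].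
rewrite take_oversize ?size_iota 1?ltnW //.
rewrite (@eq_in_filter _ _ predT (iota 0 n)) ?filter_predT //.
by move=> k; rewrite mem_iota => /andP[_ kn]; rewrite (ltn_trans kn).
Qed.

Lemma sum_ltS (n : nat) (f : 'I_n -> int) (j : 'I_n) :
  \sum_(k < n | (k <= j)%N) f k = \sum_(k < n | (k < j)%N) f k + f j.
Proof.
rewrite (bigD1 j) //= addrC; congr (_ + _); apply: eq_bigl => k.
by rewrite ltn_neqAle andbC.
Qed.

Lemma asm_line_lt (n : nat) (f : 'I_n -> int) (j : 'I_n) :
    asm_line [seq f k | k : 'I_n] ->
  [\/ f j = 0, f j = 1 /\ \sum_(k < n | (k < j)%N) f k = 0
    | f j = -1 /\ \sum_(k < n | (k < j)%N) f k = 1].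
Proof.
move=> fL; have := asm_line_sum j fL; have := asm_line_sum j.+1 fL.
rewrite sum_ltS; have: f j \in [:: -1; 0; 1 : int].
  by case/and3P: fL => /allP fL _ _; apply: fL; apply: map_f; rewrite mem_enum.
rewrite !inE => /or3P[]/eqP-> + /orP[]/eqP sE; rewrite sE //; move=> _.
- by apply: Or33.
- by apply: Or31.
- by apply: Or31.
- by apply: Or32.
Qed.

Section Phi.
Variables (n : nat) (A : asm n).
Implicit Types i j : 'I_n.

Lemma asm_row i : asm_line [seq A i j | j : 'I_n].
Proof. by case/andP: (asmP A) => /forallP. Qed.

Lemma asm_col j : asm_line [seq A i j | i : 'I_n].
Proof. by case/andP: (asmP A) => _ /forallP. Qed.

Lemma Phi_meets_right i j : meets_right (Phi_tile A i j) = right_edge A i j.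
Proof.
rewrite /Phi_tile; case: (asm_line_lt j (asm_row i)) => [E|[E F]|[E F]].
- by rewrite E /=; do 2!case: ifP.
- by rewrite /right_edge sum_ltS E F.
- by rewrite /right_edge sum_ltS E F.
Qed.

Lemma Phi_meets_bottom i j : meets_bottom (Phi_tile A i j) = bottom_edge A i j.
Proof.
rewrite /Phi_tile.
case: (asm_line_lt i (asm_col j)) => [E|[E F]|[E F]].
- by rewrite E /=; do 2!case: ifP.
- by rewrite /bottom_edge (sum_ltS (A ^~ j)) E F.
- by rewrite /bottom_edge (sum_ltS (A ^~ j)) E F.
Qed.

Lemma Phi_meets_left i j :
  meets_left (Phi_tile A i j) = (\sum_(k < n | (k < j)%N) A i k == 1).
Proof.
rewrite /Phi_tile; case: (asm_line_lt j (asm_row i)) => [E|[E F]|[E F]].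
- rewrite E /= /right_edge sum_ltS E addr0.
  by case: (_ == 1); case: (bottom_edge A i j).
- by rewrite E F.
- by rewrite E F.
Qed.

Lemma Phi_meets_top i j :
  meets_top (Phi_tile A i j) = (\sum_(k < n | (k < i)%N) A k j == 1).
Proof.
rewrite /Phi_tile; case: (asm_line_lt i (asm_col j)) => [E|[E F]|[E F]].
- rewrite E /= /bottom_edge (sum_ltS (A ^~ j)) E addr0.
  by case: (right_edge A i j); case: (_ == 1).
- by rewrite E F.
- by rewrite E F.
Qed.

Lemma Phi_is_bpd : is_bpd (Phi_tile A).
Proof.
split=> [i j j' e|i i' j e|i j e|i j e|i j e|i j e].
- rewrite Phi_meets_right Phi_meets_left /right_edge.
  by under [in RHS]eq_bigl => k do rewrite e ltnS.
- rewrite Phi_meets_bottom Phi_meets_top /bottom_edge.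
  by under [in RHS]eq_bigl => k do rewrite e ltnS.
- rewrite Phi_meets_right /right_edge.
  under eq_bigl => k do rewrite -ltnS e ltn_ord.
  by case/and3P: (asm_row i) => _ _; rewrite big_map big_enum.
- rewrite Phi_meets_bottom /bottom_edge.
  under eq_bigl => k do rewrite -ltnS e ltn_ord.
  by case/and3P: (asm_col j) => _ _; rewrite big_map big_enum.
- by rewrite Phi_meets_left big_pred0 // => k; rewrite e.
- by rewrite Phi_meets_top big_pred0 // => k; rewrite e.
Qed.

Definition Phi : bpd n := BPD Phi_is_bpd.

End Phi.

(** * Demazure product *)

(* [route t l b] is the pair of labels leaving [t] through its right and top
   edges when [l] and [b] enter through its left and bottom edges; [None]
   stands for an edge met by no pipe. At a crossing the smaller label leaves
   through the right edge. *)
Definition route (n : nat) (t : tile) (l b : option 'I_n) :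
    option 'I_n * option 'I_n :=
  match t with
  | DownElbow => (b, None)
  | UpElbow => (None, l)
  | Crossing =>
      if (l, b) is (Some x, Some y)
      then if (x <= y)%N then (l, b) else (b, l)
      else (None, None)
  | Blank => (None, None)
  | Horizontal => (l, None)
  | Vertical => (None, b)
  end.

(* Total access by natural numbers, so that labels can be propagated by
   recursion on [nat]; only used within the grid. *)
Definition cell (n : nat) (P : 'I_n -> 'I_n -> tile) (i j : nat) : tile :=
  if (insub i, insub j) is (Some i', Some j') then P i' j' else Blank.

(* The label on the left edge of column [j] in a row with tiles [row], whose
   bottom edges carry the labels [bot]. *)
Fixpoint left_label (n : nat) (row : nat -> tile) (bot : nat -> option 'I_n)
    (j : nat) : option 'I_n :=
  if j is j'.+1
  then (route (row j') (left_label row bot j') (bot j')).1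
  else None.

(* The label on the horizontal edge of column [j] lying [m] rows above the
   bottom boundary; [insub j] puts label [j] on the boundary itself. *)
Fixpoint up_label (n : nat) (P : 'I_n -> 'I_n -> tile) (m : nat) (j : nat) :
    option 'I_n :=
  if m is m'.+1
  then (route (cell P (n - m) j)
          (left_label (cell P (n - m)) (up_label P m') j) (up_label P m' j)).2
  else insub j.

Definition exit_label (n : nat) (P : 'I_n -> 'I_n -> tile) (i : 'I_n) :
    option 'I_n :=
  left_label (cell P i) (up_label P (n - i.+1)) n.

Lemma cellE (n : nat) (P : 'I_n -> 'I_n -> tile) (i j : 'I_n) :
  cell P i j = P i j.
Proof. by rewrite /cell !valK. Qed.

Lemma route_meets (n : nat) (t : tile) (l b : option 'I_n) :
    isSome l = meets_left t -> isSome b = meets_bottom t ->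
  [/\ isSome (route t l b).1 = meets_right t,
      isSome (route t l b).2 = meets_top t
    & forall x : 'I_n,
        ((route t l b).2 == Some x) + ((route t l b).1 == Some x)
        = (b == Some x) + (l == Some x) :> nat]%N.
Proof.
have sC (y z x : 'I_n) : ((Some y == Some x) + (Some z == Some x)
                        = (Some z == Some x) + (Some y == Some x))%N.
  by rewrite addnC.
case: t l b => [] [l|] [b|] //= _ _; split=> //=; try by case: ifP.
all: by move=> x; try case: ifP => _ //=; rewrite ?addn0 // sC.
Qed.

Section Demazure.
Variables (n : nat) (P : bpd n).
Implicit Types i j x : 'I_n.

Lemma left_label_meets i (bot : nat -> option 'I_n) :
    (forall j, isSome (bot j) = meets_bottom (P i j)) ->
  [/\ forall j, isSome (left_label (cell P i) bot j) = meets_left (P i j),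
      (0 < n)%N -> isSome (left_label (cell P i) bot n)
    & forall x k, (k <= n)%N ->
      (\sum_(0 <= j < k)
         ((route (cell P i j) (left_label (cell P i) bot j) (bot j)).2
            == Some x)
       + (left_label (cell P i) bot k == Some x)
       = \sum_(0 <= j < k) (bot j == Some x))%N].
Proof.
move=> botP.
have leftP j : isSome (left_label (cell P i) bot j) = meets_left (P i j).
  case: j => j jn; elim: j jn => [|j IHj] jn /=.
    by rewrite (negbTE (bpd_left (bpdP P) _ _)).
  pose j0 := Ordinal (ltnW jn); have := IHj (ltnW jn).
  rewrite -(@bpd_inner_v _ _ (bpdP P) i j0 (Ordinal jn) erefl) => Hl.
  by rewrite -[j]/(val j0) cellE; case: (route_meets Hl (botP j0)).
split=> //.
  case: n P i bot botP leftP => // n' P' i bot botP leftP _ /=.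
  rewrite -[n']/(val (ord_max : 'I_n'.+1)) cellE.
  case: (route_meets (leftP ord_max) (botP ord_max)) => -> _ _.
  exact: (bpd_right (bpdP P')).
move=> x; elim=> [|k IHk] kn; first by rewrite !big_nil.
rewrite !big_nat_recr //= -IHk 1?ltnW //.
pose k0 := Ordinal kn; have := route_meets (leftP k0) (botP k0).
rewrite -cellE /= => -[_ _ /(_ x) E].
by rewrite -addnA E addnCA addnC -addnA addnC -!addnA.
Qed.

Lemma up_label_meets m i j : (m + i.+1 = n)%N ->
  isSome (up_label P m j) = meets_bottom (P i j).
Proof.
elim: m i j => [|m IHm] i j e /=.
  by rewrite valK (bpd_bottom (bpdP P)).
have i1n : (i.+1 < n)%N by rewrite -[X in (_ < X)%N]e addSn ltnS leq_addl.
pose i' := Ordinal i1n.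
have Hb j1 : isSome (up_label P m j1) = meets_bottom (P i' j1).
  by apply: IHm; rewrite /= addnS -addSn.
have -> : (n - m.+1)%N = i' by rewrite -[X in (X - _)%N]e addKn.
case: (left_label_meets Hb) => Hl _ _.
rewrite cellE; case: (route_meets (Hl j) (Hb j)) => _ -> _.
by rewrite (@bpd_inner_h _ _ (bpdP P) i i' j erefl).
Qed.

Lemma exit_labelP i : isSome (exit_label P i).
Proof.
have Hb j : isSome (up_label P (n - i.+1) j) = meets_bottom (P i j).
  by apply: up_label_meets; rewrite subnK.
by case: (left_label_meets Hb) => _ -> //; exact: leq_ltn_trans (leq0n i) (ltn_ord i).
Qed.

Lemma up_label_count x m : (m <= n)%N ->
  (\sum_(0 <= j < n) (up_label P m j == Some x)
   + \sum_(i < n | n - i <= m) (exit_label P i == Some x) = 1)%N.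
Proof.
elim: m => [|m IHm] mn.
  rewrite [X in (_ + X)%N]big_pred0 => [|i]; last first.
    by apply/negbTE; rewrite -ltnNge subn_gt0.
  rewrite addn0 big_mkord (bigD1 x) //= valK eqxx big1 ?addn0 // => i ix.
  by rewrite valK /eq_op /= (negbTE ix).
rewrite -(IHm (ltnW mn)).
have imn : (n - m.+1 < n)%N by rewrite ltn_subrL (leq_ltn_trans _ mn).
pose i := Ordinal imn.
have ei : (n - i = m.+1)%N by rewrite subKn.
have Hb j : isSome (up_label P m j) = meets_bottom (P i j).
  by apply: up_label_meets; rewrite /= -subSn // subSS subnKC // ltnW.
case: (left_label_meets Hb) => _ _ /(_ x n (leqnn n)) <-.
rewrite (bigD1 i) /= ?ei // -!addnA; congr (_ + (_ + _))%N.
  by rewrite /exit_label -subSn // subSS /= subKn ?(ltnW mn).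
apply: eq_bigl => k; rewrite leq_eqVlt ltnS.
have [->|ki] := eqVneq k i; first by rewrite andbF ei ltnn.
rewrite andbT; case: eqP => // ek; case/eqP: ki; apply: val_inj => /=.
by rewrite -ek subKn // ltnW.
Qed.

Lemma exit_label_inj : injective (exit_label P).
Proof.
move=> i j eij; apply/eqP/negPn/negP => ij.
have [x ex] : exists x, exit_label P i = Some x.
  by move: (exit_labelP i); case: exit_label => // x; exists x.
have := up_label_count x (leqnn n).
rewrite (bigD1 i) ?leq_subr //= (bigD1 j) ?leq_subr 1?eq_sym //=.
by rewrite -eij ex eqxx !addnA addnAC addn1 addnAC addn1.
Qed.

Definition demazure_fun i : 'I_n := odflt i (exit_label P i).

Lemma demazure_inj : injective demazure_fun.
Proof.
move=> i j; rewrite /demazure_fun => eij; apply: exit_label_inj.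
move: (exit_labelP i) (exit_labelP j) eij.
by case: exit_label => // x _; case: exit_label => //= y _ ->.
Qed.

Definition demazure : 'S_n := perm demazure_inj.

Lemma demazureE i : exit_label P i = Some (demazure i).
Proof.
by rewrite permE /demazure_fun; have := exit_labelP i; case: exit_label.
Qed.

End Demazure.

(** * Inflation and key *)

Section Inflation.
Variables (n : nat).
Implicit Types (A : 'M[int]_n) (p q r : 'I_n * 'I_n) (i j a b : 'I_n).

Definition in_box (i j a b : 'I_n) (r : 'I_n * 'I_n) : bool :=
  ((i <= r.1 <= a) && (j <= r.2 <= b))%N.

Definition is_pivot A a b p : bool :=
  [&& p != (a, b), (p.1 <= a)%N, (p.2 <= b)%N, A p.1 p.2 == 1
    & [forall r, in_box p.1 p.2 a b r && (A r.1 r.2 != 0)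
                   ==> (r == p) || (r == (a, b))]].

(* Pivots lie in distinct rows and columns, so listing them by increasing row
   lists them by decreasing column. *)
Definition pivots A a b : seq ('I_n * 'I_n) :=
  sort (fun p q => (p.1 <= q.1)%N) (enum (is_pivot A a b)).

Definition corners (s : seq ('I_n * 'I_n)) : seq ('I_n * 'I_n) :=
  [seq (pq.1.1, pq.2.2) | pq <- zip s (behead s)].

Definition removable A a b : bool :=
  (A a b == -1) &&
  all (fun c => [forall r, in_box c.1 c.2 a b r && (A r.1 r.2 < 0)
                             ==> (r == (a, b))])
      (corners (pivots A a b)).

Definition inflate A a b : 'M[int]_n :=
  \matrix_(i, j)
    if (i, j) \in corners (pivots A a b) then 1
    else if ((i, j) == (a, b)) || ((i, j) \in pivots A a b) then 0
    else A i j.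

(* [p] is the leftmost -1 in the topmost row with negative entries. *)
Definition is_first_neg A p : bool :=
  (A p.1 p.2 == -1) &&
  [forall r, (A r.1 r.2 < 0) ==>
     ((p.1 < r.1)%N || (p.1 == r.1) && (p.2 <= r.2)%N)].

(* Inflation is only defined at a removable -1. *)
Definition inflate_first A : 'M[int]_n :=
  if [pick p | is_first_neg A p] is Some p then
    if removable A p.1 p.2 then inflate A p.1 p.2 else A
  else A.

(* Each inflation of an alternating sign matrix lowers the number of negative
   entries by one, so this many steps exhaust them. The result is kept as a
   matrix; the permutation [w] with 1's at positions [(i, w i)] corresponds to
   the matrix [perm_mx w]. *)
Definition asm_key A : 'M[int]_n :=
  iter #|[set p : 'I_n * 'I_n | A p.1 p.2 < 0]| inflate_first A.

End Inflation.

(* Main.v *)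
Require Import Defs.
From mathcomp Require Import all_boot all_order all_fingroup all_algebra.
From mathcomp Require Import zify.

Set Implicit Arguments.
Unset Strict Implicit.
Unset Printing Implicit Defensive.

Import Order.TTheory GRing.Theory Num.Theory.
Local Open Scope ring_scope.

(* Inflation at (a, b) adds to A the matrix whose row i is the indicator of
   column e(i+1) minus that of column e(i), where e(i), for i <= a, is the column of the
   topmost pivot weakly below row i, and e(i) = b below row a. Let T(d) be the
   row with entry 1 in column d and -1 in column b. Stacking row i of A on top
   of T(e(i+1)) and stacking T(e(i)) on top of row i of the inflated matrix give
   the same column sums, and the two stacks route labels identically: where both
   rows carry a pipe, the labels they carry agree up to order, and the top edge
   always gets the largest of the three labels involved. By induction from the
   bottom row upwards, below row i the labels of A are obtained from those of
   the inflated matrix by applying T(e(i+1)), and the exit labels agree. So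
   inflation preserves the Demazure product, and a matrix without negative
   entries is its own key. *)

(** * Partial sums and the alternating condition *)

Definition psum (f : nat -> int) (p : nat) : int := \sum_(0 <= k < p) f k.

(** With total 1 this is the alternating condition on a line, in a form that is easy to check after
    adding another line. *)
Definition unit_sums (f : nat -> int) : Prop :=
  forall p, 0 <= psum f p <= 1.

Implicit Types f g : nat -> int.

Lemma psumS f p : psum f p.+1 = psum f p + f p.
Proof. by rewrite /psum big_nat_recr. Qed.

Lemma eq_psum f g p : (forall k, (k < p)%N -> f k = g k) -> psum f p = psum g p.
Proof. by move=> fg; apply: eq_big_nat => k /= kp; exact: fg. Qed.

Lemma psumD f g p : psum (fun k => f k + g k) p = psum f p + psum g p.
Proof. exact: big_split. Qed.

Lemma psumB f g p : psum (fun k => f k - g k) p = psum f p - psum g p.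
Proof. by rewrite /psum sumrB. Qed.

Lemma psum0 f p : (forall k, (k < p)%N -> f k = 0) -> psum f p = 0.
Proof. by move=> f0; rewrite /psum big_nat big1. Qed.

Lemma psum_eq_op (c p : nat) : psum (fun k => (k == c)%:Z) p = (c < p)%N.
Proof.
elim: p => [|p IHp]; first by rewrite /psum big_geq.
by rewrite psumS IHp; lia.
Qed.

Lemma psum_const f p q :
  (p <= q)%N -> (forall k, (p <= k < q)%N -> f k = 0) -> psum f q = psum f p.
Proof.
move=> pq f0; rewrite /psum (@big_cat_nat _ _ _ p 0 q) //=.
by rewrite [X in _ + X]big1_seq ?addr0 // => k; rewrite mem_index_iota => /f0.
Qed.

Lemma psum_mono f p q :
  (p <= q)%N -> (forall k, (p <= k < q)%N -> 0 <= f k) -> psum f p <= psum f q.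
Proof.
move=> pq f_ge0; rewrite /psum (@big_cat_nat _ _ _ p 0 q) //=
  lerDl big_nat.
exact: sumr_ge0.
Qed.

Lemma asm_line_unit_sums (s : seq int) :
  (forall k, 0 <= \sum_(x <- take k s) x <= 1) -> \sum_(x <- s) x = 1 ->
  asm_line s.
Proof.
move=> s01 sum_s; rewrite /asm_line sum_s eqxx andbT.
(* [c] is the partial sum so far, so the last nonzero entry was 1 or -1 according to [c]. Starting
   from [false] pretends a leading -1, which [path_sorted] drops. *)
have key t (c : bool) : (forall k, 0 <= c%:Z + \sum_(x <- take k t) x <= 1) ->
    all (mem [:: -1; 0; 1 : int]) t &&
    path (fun x y : int => x * y < 0) (if c then 1 else -1)
      [seq x <- t | x != 0].
  elim: t c => //= x t IHt c xt01.
  have := xt01 1%N; rewrite /= take0 big_seq1 => x01.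
  have xt k : 0 <= (c%:Z + x) + \sum_(y <- take k t) y <= 1.
    by have := xt01 k.+1; rewrite /= big_cons addrA.
  have [c' xE] : exists c' : bool, c%:Z + x = c'%:Z.
    by exists (c%:Z + x == 1); case: eqP; lia.
  have t01 k : 0 <= c'%:Z + \sum_(y <- take k t) y <= 1 by rewrite -xE.
  have /andP[-> t_path] := IHt _ t01.
  move: t_path; clear - xE; rewrite andbT.
  have -> : x = c'%:Z - c%:Z by lia.
  by case: c c' {xE} => [] [] //= ->.
have s01' k : 0 <= false%:Z + \sum_(x <- take k s) x <= 1 by rewrite add0r.
by have /andP[-> /path_sorted ->] := key s false s01'.
Qed.

Lemma asm_line_iota (f : nat -> int) n :
    (forall k, (n <= k)%N -> f k = 0) ->
  asm_line [seq f k | k <- iota 0 n] <-> unit_sums f /\ psum f n = 1.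
Proof.
move=> f0.
have sum_take k : \sum_(x <- take k [seq f k | k <- iota 0 n]) x = psum f k.
  rewrite -map_take take_iota big_map; case: (leqP k n) => [kn|/ltnW nk].
    by rewrite /psum /index_iota subn0.
  rewrite (psum_const nk) => [|i /andP[/f0] //].
  by rewrite /psum /index_iota subn0.
have sum_n : \sum_(x <- [seq f k | k <- iota 0 n]) x = psum f n.
  by rewrite -(sum_take n) take_oversize // size_map size_iota.
split=> [fL|[f01 fn]]; last first.
  apply: asm_line_unit_sums; last by rewrite sum_n.
  by move=> k; rewrite sum_take.
split; last by case/and3P: fL => _ _ /eqP; rewrite sum_n.
by move=> p; have := asm_line_take p fL; rewrite sum_take; lia.
Qed.

(** The value 0 outside the grid keeps partial sums constant beyond [n]. *)
Definition entry n (A : 'M[int]_n) (i j : nat) : int :=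
  if (insub i, insub j) is (Some i', Some j') then A i' j' else 0.

Lemma entryE n (A : 'M[int]_n) (i j : 'I_n) : entry A i j = A i j.
Proof. by rewrite /entry !valK. Qed.

Lemma entry_out n (A : 'M[int]_n) i j :
  (n <= i)%N || (n <= j)%N -> entry A i j = 0.
Proof.
rewrite /entry; case: (insubP 'I_n i) => //= i' ilt _.
by case: (insubP 'I_n j) => //= j' jlt _; lia.
Qed.

Lemma is_asmP n (A : 'M[int]_n) :
  is_asm A <->
  [/\ forall i, unit_sums (entry A i), forall j, unit_sums (entry A ^~ j),
      forall i, (i < n)%N -> psum (entry A i) n = 1
    & forall j, (j < n)%N -> psum (entry A ^~ j) n = 1].
Proof.
have rowE (i : 'I_n) :
    [seq A i j | j : 'I_n] = [seq entry A i k | k <- iota 0 n].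
  rewrite -val_enum_ord -map_comp; apply: eq_map => j /=.
  by rewrite entryE.
have colE (j : 'I_n) :
    [seq A i j | i : 'I_n] = [seq entry A k j | k <- iota 0 n].
  rewrite -val_enum_ord -map_comp; apply: eq_map => i /=.
  by rewrite entryE.
have rowP (i : 'I_n) := @asm_line_iota (entry A i) n
  (fun k nk => entry_out A (introT orP (or_intror nk))).
have colP (j : 'I_n) := @asm_line_iota (entry A ^~ j) n
  (fun k nk => entry_out A (introT orP (or_introl nk))).
split=> [/andP[/forallP Ar /forallP Ac]|[r01 c01 rn cn]]; last first.
  apply/andP; split; apply/forallP => i.
    by rewrite rowE; apply/rowP; split; [exact: r01 | exact: rn].
  by rewrite colE; apply/colP; split; [exact: c01 | exact: cn].
have us0 f : (forall k, f k = 0) -> unit_sums f by move=> f0 p; rewrite psum0.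
split=> i; last 2 first.
- by move=> il; have := Ar (Ordinal il); rewrite rowE => /rowP[].
- by move=> il; have := Ac (Ordinal il); rewrite colE => /colP[].
- have [il|nl] := ltnP i n; last by apply: us0 => k; rewrite entry_out ?nl.
  by have := Ar (Ordinal il); rewrite rowE => /rowP[].
- have [il|nl] := ltnP i n; last first.
    by apply: us0 => k; rewrite entry_out ?nl ?orbT.
  by have := Ac (Ordinal il); rewrite colE => /colP[].
Qed.

(** * Labels in one row and in two stacked rows *)

Section Labels.
Variable n : nat.
Implicit Types (l b x y w : option 'I_n) (v u : nat -> option 'I_n).

(** With at most one label present the pipe goes straight, so one rule covers crossing, horizontal,
    vertical and blank tiles. *)
Definition cross l b : option 'I_n * option 'I_n :=
  if (l, b) is (Some x, Some y) then if (x <= y)%N then (l, b) else (b, l)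
  else (l, b).

Definition step (a : int) l b : option 'I_n * option 'I_n :=
  if a == 1 then (b, None) else if a == -1 then (None, l) else cross l b.

(* The row with entries [f] and bottom labels [v]: [run f v j] is the label on
   the left edge of column [j], and [out f v j] the label on its top edge. *)
Fixpoint run f v j : option 'I_n :=
  if j is j'.+1 then (step (f j') (run f v j') (v j')).1 else None.

Definition out f v j : option 'I_n := (step (f j) (run f v j) (v j)).2.

Lemma runS f v j : run f v j.+1 = (step (f j) (run f v j) (v j)).1.
Proof. by []. Qed.

Lemma eq_run f g v u j :
    (forall k, (k < j)%N -> f k = g k) -> (forall k, (k < j)%N -> v k = u k) ->
  run f v j = run g u j.
Proof.
elim: j => //= j IHj fg vw; rewrite fg ?vw // IHj // => k kj.
  by rewrite fg // ltnW.
by rewrite vw // ltnW.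
Qed.

Lemma eq_out f g v u j :
    (forall k, (k <= j)%N -> f k = g k) ->
    (forall k, (k <= j)%N -> v k = u k) ->
  out f v j = out g u j.
Proof.
move=> fg vw; rewrite /out fg ?vw // (@eq_run f g v u j) // => k /ltnW.
  exact: fg.
exact: vw.
Qed.

Lemma run_None f v j : (forall k, (k < j)%N -> f k != 1) -> run f v j = None.
Proof.
elim: j => //= j IHj f1; rewrite IHj => [|k kj]; last by rewrite f1 // ltnW.
by rewrite /step (negPf (f1 _ _)) //; case: ifP.
Qed.

Lemma run0 f v j : (forall k, f k = 0) -> run f v j = None.
Proof. by move=> f0; apply: run_None => k _; rewrite f0. Qed.

Lemma out0 f v j : (forall k, f k = 0) -> out f v j = v j.
Proof. by move=> f0; rewrite /out run0 // f0. Qed.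

(* The labels carried by two stacked rows, up to the order of the rows; in
   the second pair they are sorted. *)
Definition same_pair x y x' y' : Prop :=
  (x = x' /\ y = y' \/ x = y' /\ y = x') /\
  (if (x', y') is (Some p, Some q) then (p <= q)%N else true).

(* [a] and [f] are the entries of the lower and of the upper row in one column
   of the first stack, [f'] and [a'] those in the second. *)
Definition swaps (a f f' a' : int) x y x' y' w : Prop :=
  let: (y1, w1) := step a y w in let: (x1, t) := step f x w1 in
  let: (x1', w1') := step f' x' w in let: (y1', t') := step a' y' w1' in
  t = t' /\ same_pair x1 y1 x1' y1'.

Lemma eq_Some_ord (p q : 'I_n) : p = q :> nat -> Some p = Some q.
Proof. by move/val_inj->. Qed.

Ltac solve_swaps :=
  rewrite /same_pair /swaps /step /cross /=;
  move=> [[[? ?]|[? ?]] ?]; intros; subst;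
  repeat (match goal with o : option _ |- _ => destruct o end); simpl in *;
  try discriminate;
  repeat (case: ifP => //= ?); try (exfalso; lia);
  repeat split;
  first [by [] | by apply: eq_Some_ord; lia | lia
    | by left; split=> //; apply: eq_Some_ord; lia
    | by right; split=> //; apply: eq_Some_ord; lia].

(* The top edge gets the largest of the labels [x], [y], [w], so the order in
   which the rows carry [x] and [y] does not matter. *)
Lemma swaps0 x y x' y' w :
  same_pair x y x' y' -> swaps 0 0 0 0 x y x' y' w.
Proof. solve_swaps. Qed.

Lemma swaps_same a x x' w :
  same_pair x None x' None -> swaps 0 a a 0 x None x' None w.
Proof.
move=> [xx' _]; have <- : x = x' by case: xx' => [[-> _]|[-> <-]].
have sN z : step 0 None z = (None, z) by case: z.
rewrite /swaps sN; case: (step a x w) => x1 t; rewrite sN.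
by split=> //; split; [left | case: x1].
Qed.

(** The digits in this and the next two names are the entries [a], [f], [f'], [a']. *)
Lemma swaps_0101 y x' w :
  same_pair None y x' None -> swaps 0 1 0 1 None y x' None w.
Proof. solve_swaps. Qed.

(** The crossing in the second stack leaves the smaller label in the lower row, as the order in
    [same_pair] demands. *)
Lemma swaps_1001 x x' w :
  same_pair x None x' None -> swaps 1 0 0 1 x None x' None w.
Proof. solve_swaps. Qed.

Lemma swaps_1010 w : swaps 1 0 1 0 None None None None w.
Proof. by split=> //; split; [right | case: w]. Qed.

(** If both labels are present, a crossing in the first stack sends the larger of [x] and [y] up; in
    the second [y'] goes up directly, and it is the larger since that pair is sorted. *)
Lemma swaps_end x y x' y' : same_pair x y x' y' ->
  isSome y -> isSome y' -> swaps (-1) 0 0 (-1) x y x' y' None.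
Proof. solve_swaps. Qed.

Lemma swaps_neg x x' y' : same_pair x None x' y' ->
  isSome y' -> swaps 0 (-1) 0 (-1) x None x' y' None.
Proof. solve_swaps. Qed.

Lemma swaps_1 y x' :
  same_pair None y x' None -> swaps (-1) 1 0 0 None y x' None None.
Proof. solve_swaps. Qed.

Lemma isSome_step1 a l b : isSome (step a l b).1 =
  if a == 1 then isSome b else if a == -1 then false else isSome l.
Proof.
rewrite /step /cross; do 2!case: ifP => // _.
by case: l b => [x|] [y|] //=; case: ifP.
Qed.

Lemma isSome_step2 a l b : isSome (step a l b).2 =
  if a == 1 then false else if a == -1 then isSome l else isSome b.
Proof.
rewrite /step /cross; do 2!case: ifP => // _.
by case: l b => [x|] [y|] //=; case: ifP.
Qed.

(* [hop d b] is the row that moves the label in column [d] to column [b]. *)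
Definition hop (d b j : nat) : int := (j == d)%:Z - (j == b)%:Z.

Lemma hop_eq1 (d b j : nat) : (hop d b j == 1) = (j == d) && (d != b).
Proof. by rewrite /hop; lia. Qed.

Lemma hop_eqN1 (d b j : nat) : (hop d b j == -1) = (j == b) && (d != b).
Proof. by rewrite /hop; lia. Qed.

Section Swap.
Variables (f f' : nat -> int) (v : nat -> option 'I_n) (d c b : nat).
Hypothesis f'E : forall j, f' j = f j + hop d b j - hop c b j.
Hypothesis v_d : (d < b)%N -> isSome (v d).
Hypothesis v_c : (c < b)%N -> isSome (v c).

Let x j := run f (out (hop d b) v) j.
Let y j := run (hop d b) v j.
Let x' j := run f' v j.
Let y' j := run (hop c b) (out f' v) j.

(** For row [i], with [d] = e(i+1) and [c] = e(i), the cases are: both extra rows are zero; the row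
    [a] of the -1, where only [hop d b] is zero; a row above [a] that holds no pivot; a row above
    [a] with a pivot in column [c]. *)
Definition hop_row : Prop :=
  [\/ d = b /\ c = b,
      [/\ d = b, (c < b)%N
        & [/\ f c = 1, f b = -1 & forall k, (k < b)%N -> k != c -> f k = 0]],
      [/\ d = c, (c < b)%N & forall k, (d <= k <= b)%N -> f k = 0]
    | [/\ (d < c)%N, (c <= b)%N
        & f c = 1 /\ forall k, (k <= b)%N -> k != c -> f k = 0]].

Hypothesis f_row : hop_row.
Hypothesis v_b : (d < b)%N || (c < b)%N -> v b = None.

Lemma swap_step j :
    same_pair (x j) (y j) (x' j) (y' j) ->
    isSome (y j) = (d < j <= b)%N -> isSome (y' j) = (c < j <= b)%N ->
  swaps (hop d b j) (f j) (f' j) (hop c b j) (x j) (y j) (x' j) (y' j) (v j).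
Proof.
move=> xy yS y'S.
have NN z : isSome z = false -> z = None :> option 'I_n by case: z.
have yN : ~~ (d < j <= b)%N -> y j = None by move=> h; apply: NN; lia.
have y'N : ~~ (c < j <= b)%N -> y' j = None by move=> h; apply: NN; lia.
have xN : (forall k, (k < j)%N -> f k = 0) -> x j = None.
  by move=> f0; apply: run_None => k /f0->.
have vN : j = b -> (d < b)%N || (c < b)%N -> v j = None by move=> ->.
pose goal a r r' a' := swaps a r r' a' (x j) (y j) (x' j) (y' j) (v j).
(* The entry of [f'] is forced by the other three, so each case only names those. *)
have at_ a r a' : hop d b j = a -> f j = r -> hop c b j = a' ->
    goal a r (r + a - a') a' -> goal (hop d b j) (f j) (f' j) (hop c b j).
  by rewrite f'E => -> -> ->.
have same : hop d b j = 0 -> hop c b j = 0 -> ~~ (d < j <= b)%N ->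
    ~~ (c < j <= b)%N -> goal (hop d b j) (f j) (f' j) (hop c b j).
  move=> h1 h2 /yN h3 /y'N h4; apply: (at_ 0 (f j) 0) => //.
  rewrite addr0 subr0 /goal h3 h4; rewrite h3 h4 in xy; exact: swaps_same.
have zero : hop d b j = 0 -> hop c b j = 0 -> f j = 0 ->
    goal (hop d b j) (f j) (f' j) (hop c b j).
  by move=> h1 h2 h3; apply: (at_ 0 0 0) => //; exact: swaps0.
rewrite -/(goal _ _ _ _).
case: f_row => [[db cb]|[db cb [fc fb f0]]|[dc cb f0]|[dc cb [fc f0]]].
- by apply: same; rewrite ?/hop; lia.
- have [jc|jc|jc] := ltngtP j c.
  + by apply: same; rewrite ?/hop; lia.
  + have [jb|jb|jb] := ltngtP j b.
    * by apply: zero; rewrite ?/hop ?f0; lia.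
    * by apply: same; rewrite ?/hop; lia.
    * apply: (at_ 0 (-1) (-1)); [rewrite /hop; lia | by rewrite jb
        | rewrite /hop; lia |].
      move: xy; rewrite /goal vN ?yN //; [|lia..] => xy.
      by apply: swaps_neg => //; lia.
  + apply: (at_ 0 1 1); [rewrite /hop; lia | by rewrite jc
      | rewrite /hop; lia |].
    have xjN : x j = None by apply: xN => k kj; apply: f0; lia.
    by move: xy; rewrite /goal xjN y'N ?[y j]yN; [exact: swaps_0101 | lia..].
- have [jc|jc|jc] := ltngtP j c.
  + by apply: same; rewrite ?/hop; lia.
  + have [jb|jb|jb] := ltngtP j b.
    * by apply: zero; rewrite ?/hop ?f0; lia.
    * by apply: same; rewrite ?/hop; lia.
    * apply: (at_ (-1) 0 (-1)); [rewrite /hop; lia | apply: f0; lia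
        | rewrite /hop; lia |].
      by rewrite /goal vN; [apply: swaps_end => //; lia | lia..].
  + apply: (at_ 1 0 1); [rewrite /hop; lia | apply: f0; lia
      | rewrite /hop; lia |].
    by move: xy; rewrite /goal yN ?y'N; [exact: swaps_1001 | lia..].
- have [jd|jd|jd] := ltngtP j d.
  + by apply: same; rewrite ?/hop; lia.
  + have [jb|jb|jb] := ltngtP j b.
    * have [jc|jc] := eqVneq j c; last first.
        by apply: zero; rewrite ?/hop ?f0; lia.
      apply: (at_ 0 1 1); [rewrite /hop; lia | by rewrite jc
        | rewrite /hop; lia |].
      have xjN : x j = None by apply: xN => k kj; apply: f0; lia.
      by move: xy; rewrite /goal xjN y'N; [exact: swaps_0101 | lia..].
    * by apply: same; rewrite ?/hop; lia.
    * have [cb'|bc] := ltnP c b.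
        apply: (at_ (-1) 0 (-1)); [rewrite /hop; lia | apply: f0; lia
          | rewrite /hop; lia |].
        by rewrite /goal vN; [apply: swaps_end => //; lia | lia..].
      have jc : j = c by lia.
      apply: (at_ (-1) 1 0); [rewrite /hop; lia | by rewrite jc
        | rewrite /hop; lia |].
      have xjN : x j = None by apply: xN => k kj; apply: f0; lia.
      move: xy; rewrite /goal xjN y'N ?vN; [exact: swaps_1 | lia..].
  + apply: (at_ 1 0 0); [rewrite /hop; lia | apply: f0; lia
      | rewrite /hop; lia |].
    have xjN : x j = None by apply: xN => k kj; apply: f0; lia.
    move: xy; rewrite /goal xjN yN ?y'N; [|lia..] => xy.
    have -> : x' j = None by case: xy => [[[<-]|[_ <-]]].
    exact: swaps_1010.
Qed.

Lemma swaps_next j :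
    swaps (hop d b j) (f j) (f' j) (hop c b j)
      (x j) (y j) (x' j) (y' j) (v j) ->
  out f (out (hop d b) v) j = out (hop c b) (out f' v) j /\
  same_pair (x j.+1) (y j.+1) (x' j.+1) (y' j.+1).
Proof.
rewrite /x /y /x' /y' /= {1 3}/out -/(x j) -/(x' j) -/(y' j).
rewrite [out (hop d b) v j]/out [out f' v j]/out -/(y j) -/(x' j).
rewrite [out (hop c b) (out f' v) j]/out [out f' v j]/out -/(x' j) -/(y' j).
rewrite /swaps; case: (step (hop d b j) _ _) => y1 w1 /=.
case: (step (f j) _ _) => x1 t; case: (step (f' j) _ _) => x1' w1' /=.
by case: (step (hop c b j) _ _).
Qed.

(** Induction on the column. The columns in which the extra rows carry a label are tracked along,
    because [swap_step] relies on them. *)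
Lemma swap_inv j :
  [/\ same_pair (x j) (y j) (x' j) (y' j),
      isSome (y j) = (d < j <= b)%N & isSome (y' j) = (c < j <= b)%N].
Proof.
have [db cb] : (d <= b)%N /\ (c <= b)%N.
  by case: f_row => [[]|[]|[]|[]]; intros; lia.
elim: j => [|j [xy yS y'S]]; first by split; rewrite //; split=> //; left.
have [_ xyS] := swaps_next (swap_step xy yS y'S); split=> //.
- rewrite /y runS isSome_step1 hop_eq1 hop_eqN1 -/(y j) yS.
  by case: ifP => [/andP[/eqP-> db']|]; [rewrite v_d; lia | case: ifP; lia].
- rewrite /y' runS isSome_step1 hop_eq1 hop_eqN1 -/(y' j) y'S.
  have cS : j = c -> (c < b)%N -> isSome (out f' v j).
    move=> jc cb'; rewrite /out isSome_step2 jc.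
    have -> : f' c = 0.
      rewrite f'E /hop; case: f_row => [[]|[]|[]|[]]; first lia.
      + by move=> db' _ [-> _ _]; lia.
      + by move=> dc _ f0; rewrite f0; lia.
      + by move=> dc _ [-> _]; lia.
    exact: v_c.
  by case: ifP => [/andP[/eqP jc cb']|]; [rewrite cS; lia | case: ifP; lia].
Qed.

Lemma swap_out j : out f (out (hop d b) v) j = out (hop c b) (out f' v) j.
Proof.
have [xy yS y'S] := swap_inv j.
by case: (swaps_next (swap_step xy yS y'S)).
Qed.

Lemma swap_run j : (b < j)%N -> run f (out (hop d b) v) j = run f' v j.
Proof.
move=> bj; have [xy yS y'S] := swap_inv j; rewrite -/(x j) -/(x' j).
have yN : y j = None by case: (y j) yS => //= o; lia.
have y'N : y' j = None by case: (y' j) y'S => //= o; lia.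
by move: xy; rewrite yN y'N => -[[[]|[-> <-]]].
Qed.

End Swap.
End Labels.

(** * The staircase of pivots and its effect on partial sums *)

Lemma psum_gt0 (f : nat -> int) p :
  0 < psum f p -> exists2 k, (k < p)%N & 0 < f k.
Proof.
elim: p => [|p IHp]; first by rewrite /psum big_geq.
rewrite psumS; have [fp|fp] := ltrP 0 (f p); first by exists p.
move=> sp; have [|k kp fk] := IHp; first lia.
by exists k => //; exact: ltnW.
Qed.

Lemma unit_sums_range f k : unit_sums f -> -1 <= f k <= 1.
Proof. by move=> f01; have := f01 k.+1; have := f01 k; rewrite psumS; lia. Qed.

Lemma unit_sums_1 f k :
  unit_sums f -> f k = 1 -> psum f k = 0 /\ psum f k.+1 = 1.
Proof. by move=> f01; have := f01 k.+1; have := f01 k; rewrite psumS; lia. Qed.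

(** Two 1's with no negative entry between them would raise the partial sum by 2. *)
Lemma unit_sums_unique f N c k : unit_sums f ->
    (forall j, (j < N)%N -> 0 <= f j) -> (c < N)%N -> f c = 1 ->
  (k < N)%N -> k != c -> f k = 0.
Proof.
move=> f01 f_ge0 cN fc kN kc.
have two p q : (p < q)%N -> (q < N)%N -> f p + f q <= 1.
  move=> pq qN; have := f01 q.+1; have := f01 p; rewrite psumS.
  have : psum f p.+1 <= psum f q.
    by apply: psum_mono => // j jq; apply: f_ge0; lia.
  by rewrite psumS; lia.
have := f_ge0 k kN; have [kc'|ck|] := ltngtP k c; last by lia.
  by have := two _ _ kc' cN; lia.
by have := two _ _ ck kN; lia.
Qed.

Section Stair.
Variables (g : nat -> nat -> int) (a b : nat).
Hypothesis g_row : forall i, unit_sums (g i).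
Hypothesis g_col : forall j, unit_sums (g ^~ j).
Hypothesis gab : g a b = -1.
Hypothesis g_first :
  forall i j, g i j < 0 -> (a < i)%N || (a == i) && (b <= j)%N.

(* In the notation of the context, [stair i] is the column [j_l] of the topmost
   pivot weakly below row [i]; there is none below row [a], where we put [b]. *)
Definition stair (i : nat) : nat :=
  if (i <= a)%N then
    \max_(p : 'I_a.+1 * 'I_b.+1 | (i <= p.1)%N && (g p.1 p.2 == 1)) p.2
  else b.

Lemma stair_le i : (stair i <= b)%N.
Proof.
rewrite /stair; case: ifP => // _.
by apply/bigmax_leqP => -[r c] _ /=; rewrite -ltnS.
Qed.

Lemma stair_gt i : (a < i)%N -> stair i = b.
Proof. by rewrite /stair ltnNge => /negPf->. Qed.

Lemma stair_max i r c :
  (i <= r <= a)%N -> (c <= b)%N -> g r c = 1 -> (c <= stair i)%N.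
Proof.
move=> /andP[ir ra] cb grc; rewrite /stair (leq_trans ir ra).
pose p := (inord r : 'I_a.+1, inord c : 'I_b.+1).
have -> : c = p.2 by rewrite inordK.
by apply: (@leq_bigmax_cond _ _ (fun p : 'I_a.+1 * 'I_b.+1 => val p.2));
   rewrite !inordK // ir grc eqxx.
Qed.

Lemma g_ge0 i j : (i < a)%N || (i == a) && (j < b)%N -> 0 <= g i j.
Proof. by move=> ij; rewrite leNgt; apply/negP => /g_first; lia. Qed.

Lemma g_le1 i j : g i j <= 1.
Proof. by case/andP: (unit_sums_range j (g_row i)). Qed.

(** The maximum runs over a nonempty set: the -1 at [(a, b)] forces a 1 to its left in row [a]. *)
Lemma stair_mem i :
  (i <= a)%N -> exists2 r, (i <= r <= a)%N & g r (stair i) = 1.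
Proof.
move=> ia; have [|c cb gc] := @psum_gt0 (g a) b.
  by have := g_row a b.+1; rewrite psumS gab; have := g_row a b; lia.
have ga1 : g a c = 1 by have := g_le1 a c; lia.
rewrite /stair ia.
have [|[r k] /= /andP[ir /eqP gr] ->] := @eq_bigmax_cond _
   [pred p : 'I_a.+1 * 'I_b.+1 | (i <= p.1)%N && (g p.1 p.2 == 1)]
   (fun p => val p.2).
  apply/card_gt0P; exists (inord a, inord c).
  by rewrite inE /= !inordK ?ia ?ga1 // ltnW.
by exists r; rewrite // ir -ltnS ltn_ord.
Qed.

Lemma stair_a : (stair a < b)%N.
Proof.
have [r ra gr] := stair_mem (leqnn a); have rE : r = a by lia.
rewrite ltn_neqAle stair_le andbT; apply/eqP => eb.
by move: gr; rewrite rE eb gab.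
Qed.

Lemma stair_0 : stair 0 = b.
Proof.
have [|r ra gr] := @psum_gt0 (g ^~ b) a.
  by have := g_col b a.+1; rewrite psumS gab; have := g_col b a; lia.
have g1 : g r b = 1 by have := g_le1 r b; lia.
have rP : (0 <= r <= a)%N by lia.
by have := stair_max rP (leqnn b) g1; have := stair_le 0; lia.
Qed.

(** A 1 attaining [stair i] from a row below [i] counts for [stair i.+1] too, so a drop forces it
    into row [i]. *)
Lemma stair_step i : (i < a)%N ->
  stair i.+1 = stair i \/ (stair i.+1 < stair i)%N /\ g i (stair i) = 1.
Proof.
move=> ia; have [r ri gr] := stair_mem (ltnW ia).
have [r' ri' gr'] := stair_mem ia.
have ri0 : (i <= r' <= a)%N by lia.
have := stair_max ri0 (stair_le _) gr'.
rewrite leq_eqVlt => /orP[/eqP|lt]; [by left | right; split=> //].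
have [E|ne] := eqVneq r i; first by rewrite -{1}E.
have ri1 : (i < r <= a)%N by lia.
by have := stair_max ri1 (stair_le _) gr; lia.
Qed.

Lemma stair_mono i : (i < a)%N -> (stair i.+1 <= stair i)%N.
Proof. by case/stair_step => [->//|[/ltnW]]. Qed.

Lemma g_stair_a : g a (stair a) = 1.
Proof.
have [r ra] := stair_mem (leqnn a); by have -> : r = a by lia.
Qed.

(** The partial sum just before a 1 is 0, and the column has no negative entry above row [r], so
    earlier partial sums cannot be larger. *)
Lemma g_col_eq0 r c i : (c < b)%N -> g r c = 1 -> (i < r <= a)%N ->
  psum (g ^~ c) i.+1 = 0.
Proof.
move=> cb gr ri; have [r0 _] := unit_sums_1 (g_col c) gr.
have := @psum_mono (g ^~ c) i.+1 r; rewrite r0 => le0.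
have {}le0 : psum (g ^~ c) i.+1 <= 0.
  by apply: le0 => [|k kr]; [lia | apply: g_ge0; lia].
by have := g_col c i.+1; lia.
Qed.

(** Column [stair p] has a 1 at or below row [p] and no 1 before it. In column [b] the sum before
    the -1 is 1, and the rows from [p] to just above [a] hold zeros there, as a 1 would make
    [stair p] equal to [b]. *)
Lemma psum_stair p : (stair p < b)%N ->
  psum (g ^~ (stair p)) p = 0 /\ psum (g ^~ b) p = 1.
Proof.
move=> pb; have pa : (p <= a)%N.
  by rewrite leqNgt; apply/negP => /stair_gt; lia.
split.
  have [r rp gr] := stair_mem pa; case: p => [|p] in pb pa rp gr *.
    by rewrite /psum big_geq.
  by apply: g_col_eq0 gr _; lia.
have a1 : psum (g ^~ b) a = 1.
  by have := g_col b a.+1; rewrite psumS gab; have := g_col b a; lia.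
rewrite -a1; apply/esym/psum_const => // k kp.
have ka : (p <= k <= a)%N by lia.
have := @stair_max p k b ka (leqnn b); have := g_le1 k b.
by have := @g_ge0 k b; lia.
Qed.

Definition inflated (i j : nat) : int :=
  g i j + hop (stair i.+1) b j - hop (stair i) b j.

Lemma inflatedE i j : inflated i j =
  g i j + ((j == stair i.+1)%:Z - (j == stair i)%:Z).
Proof. by rewrite /inflated /hop opprB -!addrA addKr. Qed.

Lemma psum_inflated_row i p : psum (inflated i) p =
  psum (g i) p + ((stair i.+1 < p)%N%:Z - (stair i < p)%N%:Z).
Proof.
by rewrite (eq_psum (fun k _ => inflatedE i k)) psumD psumB !psum_eq_op.
Qed.

(** The changes telescope down the column, starting from [stair 0 = b]. *)
Lemma psum_inflated_col j p : psum (inflated ^~ j) p =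
  psum (g ^~ j) p + ((j == stair p)%:Z - (j == b)%:Z).
Proof.
elim: p => [|p IHp]; first by rewrite stair_0 subrr /psum !big_geq.
by rewrite !psumS IHp inflatedE; lia.
Qed.

(** At a drop above row [a] a 1 moves left, across partial sums that are 0 for lack of negative
    entries. In row [a] the 1 in column [stair a] and the -1 in column [b] disappear together;
    between them the partial sums are 1. *)
Lemma inflated_row_unit i : unit_sums (inflated i).
Proof.
move=> p; rewrite psum_inflated_row; have gp := g_row i p.
have [ia|ai|ia] := ltngtP i a.
- have [->|[lt gi]] := stair_step ia; first lia.
  have [s0 _] := unit_sums_1 (g_row i) gi.
  have := @psum_mono (g i) p (stair i); rewrite s0.
  have [ps|sp] := leqP p (stair i); last lia.
  move=> /(_ isT) le0.
  have {}le0 : psum (g i) p <= 0 by apply: le0 => k _; apply: g_ge0; lia.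
  lia.
- by rewrite !stair_gt; lia.
rewrite ia [stair a.+1]stair_gt //; have sa := stair_a.
have [_ s1] := unit_sums_1 (g_row a) g_stair_a.
have := @psum_mono (g a) (stair a).+1 p; rewrite s1 => le1; rewrite ia in gp.
have [|sp] := leqP p (stair a); first lia.
have [pb|] := leqP p b; last lia.
have : 1 <= psum (g a) p by apply: le1 => // k kp; apply: g_ge0; lia.
lia.
Qed.

Lemma inflated_col_unit j : unit_sums (inflated ^~ j).
Proof.
move=> p; rewrite psum_inflated_col; have gp := g_col j p.
have := stair_le p; rewrite leq_eqVlt => /orP[/eqP->|lt]; first lia.
have [s0 s1] := psum_stair lt.
have [js|js] := eqVneq j (stair p); first by rewrite js s0; lia.
by have [jb|jb] := eqVneq j b; [rewrite jb s1; lia | lia].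
Qed.

Lemma hop_row_stair i : hop_row (g i) (stair i.+1) (stair i) b.
Proof.
have sle := stair_le i; have [ia|ai|ia] := ltngtP i a.
- have [eqs|[lt gi]] := stair_step ia.
    have := sle; rewrite leq_eqVlt => /orP[/eqP sb|lt].
      by apply: Or41; rewrite eqs.
    (* A 1 here would by maximality stand in column [stair i.+1], which has another 1 below row [i];
       [g_col_eq0] excludes this. *)
    apply: Or43; split=> // k kb.
    apply/eqP; rewrite eq_le g_ge0 ?ia // andbT leNgt; apply/negP => gk.
    have gk1 : g i k = 1 by have := g_le1 i k; lia.
    have ip : (i <= i <= a)%N by lia.
    have kE : k = stair i.+1.
      by have := stair_max ip _ gk1; rewrite eqs in kb *; lia.
    have [r ri gr] := stair_mem ia.
    have := g_col_eq0 _ gr ri; rewrite eqs => /(_ lt).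
    rewrite kE eqs in gk1.
    by have [_ ->] := unit_sums_1 (g_col (stair i)) gk1.
  apply: Or44; split=> //; split=> // k kb ki.
  apply: (@unit_sums_unique _ b.+1 (stair i)) => // j _.
  by apply: g_ge0; rewrite ia.
- by apply: Or41; rewrite !stair_gt //; lia.
apply: Or42; rewrite ia stair_gt //; split=> //; first exact: stair_a.
split=> // [|k kb ks]; first exact: g_stair_a.
apply: (@unit_sums_unique _ b (stair a)) => // [j jb||].
- by apply: g_ge0; rewrite eqxx jb orbT.
- exact: stair_a.
- exact: g_stair_a.
Qed.

Lemma stair_drop i : stair i != stair i.+1 ->
  [/\ (i <= a)%N, g i (stair i) = 1 & (i < a)%N -> (stair i.+1 < stair i)%N].
Proof.
move=> ne; have [ia|ai|->] := ltngtP i a.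
- by have [E|[lt gi]] := stair_step ia; [rewrite E eqxx in ne | split].
- by rewrite !stair_gt ?eqxx // ltnW in ne.
by split=> //; exact: g_stair_a.
Qed.

(** This and the next two sums tell which bottom edges of row [i] carry a label for the inflated
    matrix; they discharge the hypotheses on [v] in the row swap. *)
Lemma psum_inflated_c i :
  (stair i < b)%N -> psum (inflated ^~ (stair i)) i.+1 = 1.
Proof.
move=> sb; rewrite psum_inflated_col.
have [E|ne] := eqVneq (stair i) (stair i.+1).
  by have [] := @psum_stair i.+1; rewrite -E // => -> _; lia.
have [_ gi _] := stair_drop ne; have [_ ->] := unit_sums_1 (g_col _) gi.
by lia.
Qed.

Lemma psum_inflated_d i :
  (stair i.+1 < b)%N -> psum (inflated ^~ (stair i.+1)) i.+1 = 1.
Proof.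
move=> sb; rewrite psum_inflated_col; have [-> _] := psum_stair sb; lia.
Qed.

Lemma psum_inflated_b i : (stair i.+1 < b)%N || (stair i < b)%N ->
  psum (inflated ^~ b) i.+1 = 0.
Proof.
move=> sb; rewrite psum_inflated_col.
have := stair_le i.+1; rewrite leq_eqVlt => /orP[/eqP E|lt]; last first.
  by have [_ ->] := psum_stair lt; lia.
have ia : i = a.
  have [ia|ai|//] := ltngtP i a; first by have := stair_mono ia; lia.
  by have := stair_gt ai; lia.
rewrite E ia psumS gab.
by have := g_col b a.+1; rewrite psumS gab; have := g_col b a; lia.
Qed.

(** At a drop the decreased entry is a 1, and the increased one, in column [stair i.+1], is negative
    only at [(a, b)]. *)
Lemma inflated_lt0 i j :
  (inflated i j < 0) = (g i j < 0) && ((i != a) || (j != b)).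
Proof.
rewrite inflatedE; have [E|ne] := eqVneq (stair i) (stair i.+1).
  have ia : i != a.
    apply: contra_eqN E => /eqP->.
    by have := stair_a; have := @stair_gt a.+1; lia.
  by rewrite E ia; lia.
have [ia gi lt] := stair_drop ne.
have [jc|jc] := eqVneq j (stair i); first by rewrite jc gi; lia.
have [jd|jd] := eqVneq j (stair i.+1); last first.
  suff: (g i j < 0) -> (i != a) || (j != b) by lia.
  move=> _; apply/orP; have [iE|] := eqVneq i a; [right | by left].
  by have := @stair_gt a.+1; rewrite -iE; lia.
have [lt_ia|ai] := ltnP i a.
  by have := @g_ge0 i j; lia.
have iE : i = a by lia.
have jb : j = b by rewrite jd iE stair_gt.
by rewrite iE jb gab; lia.
Qed.
End Stair.

(** * Labels of a pipe dream, row by row *)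

Section PhiLabels.
Variables (n : nat) (A : asm n).
Implicit Types (i j : 'I_n) (m : nat).

Let labels := up_label (Phi_tile A).

Lemma bottom_edge_psum i j :
  bottom_edge A i j = (psum (entry A ^~ j) i.+1 == 1).
Proof.
rewrite /bottom_edge /psum big_mkord (big_ord_widen n (entry A ^~ j)) //.
by under [in RHS]eq_bigr => k _ do rewrite entryE.
Qed.

(** The condition [m + i.+1 = n] says that level [m] consists of the bottom edges of row [i]. *)
Lemma labels_meets m i j : (m + i.+1 = n)%N ->
  isSome (labels m j) = meets_bottom (Phi_tile A i j).
Proof. exact: (up_label_meets (Phi A)). Qed.

Lemma labels_isSome m i j : (m + i.+1 = n)%N ->
  isSome (labels m j) = (psum (entry A ^~ j) i.+1 == 1).
Proof. by move/labels_meets->; rewrite Phi_meets_bottom bottom_edge_psum. Qed.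

(** A tile with entry 0 is determined by which of its left and bottom edges carry labels. *)
Lemma route_step i j (l b : option 'I_n) :
    isSome l = meets_left (Phi_tile A i j) ->
    isSome b = meets_bottom (Phi_tile A i j) ->
  route (Phi_tile A i j) l b = step (A i j) l b.
Proof.
rewrite /Phi_tile /step; case: ifP => // _; case: ifP => // _.
by case: right_edge bottom_edge l b => [] [] [x|] [y|].
Qed.

Lemma left_label_run m i (k : nat) : (m + i.+1 = n)%N -> (k <= n)%N ->
  left_label (cell (Phi_tile A) i) (labels m) k = run (entry A i) (labels m) k.
Proof.
move=> mi; have bot j := labels_meets j mi.
have [lft _ _] := @left_label_meets n (Phi A) i _ bot.
elim: k => //= k IHk kn; pose j := Ordinal kn.
by rewrite -(IHk (ltnW kn)) (cellE _ i j) (route_step (lft j) (bot j)) -entryE.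
Qed.

Lemma labelsS m i j : (m + i.+1 = n)%N ->
  labels m.+1 j = out (entry A i) (labels m) j.
Proof.
move=> mi; have bot k := labels_meets k mi.
have [lft _ _] := @left_label_meets n (Phi A) i _ bot.
have iE : (n - m.+1)%N = i by lia.
rewrite /labels /= iE cellE (route_step (lft j) (bot j)) /out -entryE.
by rewrite (left_label_run mi) // ltnW.
Qed.

Lemma exit_run i :
  exit_label (Phi A) i = run (entry A i) (labels (n - i.+1)) n.
Proof. by rewrite /exit_label left_label_run ?subnK. Qed.

End PhiLabels.

(** * Invariance of the Demazure product under inflation *)

Lemma demazure_inflated n (A A' : asm n) (a b : nat) :
    entry A a b = -1 ->
    (forall i j, entry A i j < 0 -> (a < i)%N || (a == i) && (b <= j)%N) ->
    (forall i j, entry A' i j = inflated (entry A) a b i j) ->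
  demazure (Phi A) = demazure (Phi A').
Proof.
move=> Aab first_ab A'E.
have [rowA colA _ _] := (is_asmP A).1 (asmP A).
have [an bn] : (a < n)%N /\ (b < n)%N.
  split; rewrite ltnNge; apply/negP => h; move: Aab; rewrite entry_out ?h //.
  by rewrite orbT.
pose U := up_label (Phi_tile A); pose U' := up_label (Phi_tile A').
pose e := stair (entry A) a b.
have row_i i : hop_row (entry A i) (e i.+1) (e i) b by exact: hop_row_stair.
have e_le i : (e i <= b)%N by exact: stair_le.
have U'N m (i j : 'I_n) : (m + i.+1 = n)%N ->
    psum (entry A' ^~ j) i.+1 = 0 -> U' m j = None.
  move=> mi s0; have := labels_isSome A' j mi; rewrite s0 -/U'.
  by case: (U' m j).
have U'S m (i : 'I_n) (j : nat) : (m + i.+1 = n)%N -> (j < n)%N ->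
    psum (inflated (entry A) a b ^~ j) i.+1 = 1 -> isSome (U' m j).
  move=> mi jn s1; rewrite (labels_isSome A' (Ordinal jn) mi).
  by rewrite (eq_psum (fun k _ => A'E k j)) s1.
have row_hyps m (i : 'I_n) (mi : (m + i.+1 = n)%N) :
    [/\ (e i.+1 < b)%N -> isSome (U' m (e i.+1)),
        (e i < b)%N -> isSome (U' m (e i))
      & (e i.+1 < b)%N || (e i < b)%N -> U' m b = None].
  split=> lt.
  - by apply: U'S mi _ _; [exact: ltn_trans lt bn | exact: psum_inflated_d].
  - by apply: U'S mi _ _; [exact: ltn_trans lt bn | exact: psum_inflated_c].
  - apply: (U'N m i (Ordinal bn) mi); rewrite (eq_psum (fun k _ => A'E k b)).
    exact: psum_inflated_b.
have UE m (i : 'I_n) : (m + i.+1 = n)%N ->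
    forall j, (j < n)%N -> U m j = out (hop (e i.+1) b) (U' m) j.
  elim: m i => [|m IHm] i mi j jn.
    (* Here [i.+1 = n] exceeds [a], so the extra row is zero. *)
    by rewrite out0 // => k; rewrite /hop /e stair_gt ?subrr; lia.
  have i1n : (i.+1 < n)%N by lia.
  pose i1 := Ordinal i1n; have mi1 : (m + i1.+1 = n)%N by rewrite /=; lia.
  have [v_d v_c v_b] := row_hyps m i1 mi1.
  rewrite /U (labelsS A (Ordinal jn) mi1).
  have -> : out (entry A i1) (up_label (Phi_tile A) m) j =
      out (entry A i1) (out (hop (e i1.+1) b) (U' m)) j.
    by apply: eq_out => // k kj; apply: IHm => //; exact: leq_ltn_trans kj jn.
  rewrite (swap_out (A'E i1) v_d v_c (row_i i1) v_b).
  apply: eq_out => // k kj; have kn := leq_ltn_trans kj jn.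
  by rewrite /U' (labelsS A' (Ordinal kn) mi1).
apply/permP => i; apply: Some_inj; rewrite -!demazureE !exit_run.
have mi : (n - i.+1 + i.+1 = n)%N by rewrite subnK.
have [v_d v_c v_b] := row_hyps _ i mi.
rewrite -(swap_run (A'E i) v_d v_c (row_i i) v_b bn).
by apply: eq_run => // k kn; exact: UE.
Qed.

(** * Pivots and corners read off the staircase *)

(** [E] is constant between consecutive drops, so its value at the next drop is its value just after
    the current one. The first conjunct carries the induction. By hypothesis the last index is a
    drop; it has no successor and is absent on the right. *)
Lemma consecutive_drops (E : nat -> nat) m k : E (m + k)%N != E (m + k).+1 ->
  let s := [seq i <- iota m k.+1 | E i != E i.+1] in
  (exists h t, s = h :: t /\ E h = E m) /\
  [seq (r.1, E r.2) | r <- zip s (behead s)] =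
  [seq (i, E i.+1) | i <- iota m k & E i != E i.+1].
Proof.
elim: k m => [|k IHk] m.
  by rewrite addn0 /= => ->; split=> //; exists m, [::].
rewrite -addSnnS => /IHk /= [[h [t [sE Eh]]] zE]; rewrite sE in zE *.
case: ifP => [Em|/negbFE/eqP Em] /=; last first.
  by split; [exists h, t; rewrite Em | exact: zE].
by split; [exists m, (h :: t) | rewrite Eh -zE].
Qed.

Lemma corners_rows n (E : nat -> nat) (s : seq ('I_n * 'I_n)) :
    (forall p, p \in s -> p.2 = E p.1 :> nat) ->
  let rows := [seq val p.1 | p <- s] in
  [seq (val c.1, val c.2) | c <- corners s] =
  [seq (r.1, E r.2) | r <- zip rows (behead rows)].
Proof.
case: s => // p s; elim: s p => //= q s IHs p sE; congr (_ :: _).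
  by rewrite sE // !inE eqxx orbT.
by apply: IHs => r rs; apply: sE; rewrite inE rs orbT.
Qed.

Section Inflate.
Variables (n : nat) (A : asm n) (a b : 'I_n).
Hypothesis first_ab : is_first_neg A (a, b).

Let g := entry A.
Let e := stair g a b.

Lemma first_neg_entry : g a b = -1.
Proof. by rewrite /g entryE; case/andP: first_ab => /eqP. Qed.

Lemma entry_first_neg i j :
  g i j < 0 -> (a < i)%N || (a == i :> nat) && (b <= j)%N.
Proof.
have [ij|] := boolP ((i < n) && (j < n))%N; last first.
  by rewrite negb_and -!leqNgt => ij; rewrite /g entry_out.
case/andP: ij => ilt jlt; rewrite -[i]/(val (Ordinal ilt)).
rewrite -[j]/(val (Ordinal jlt)) /g entryE.
by case/andP: first_ab => _ /forallP/(_ (Ordinal ilt, Ordinal jlt))/implyP.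
Qed.

Let gab := first_neg_entry.
Let gfirst := entry_first_neg.
Let grow : forall i, unit_sums (g i).
Proof. by case: ((is_asmP A).1 (asmP A)). Qed.

(** If [p] is a pivot, the 1 attaining [e p.1] lies in its box and so is [p]; above row [a], without
    a drop the box would hold another 1 below [p]. Conversely, at a drop any other 1 in the box
    would contradict the maximality of [e] at row [p.1] or just below. *)
Lemma is_pivotE (p : 'I_n * 'I_n) :
  is_pivot A a b p = (p.2 == e p.1 :> nat) && (e p.1 != e p.1.+1).
Proof.
apply/idP/andP.
  case/and5P=> pab pa pb /eqP Ap /forallP box.
  have gp : g p.1 p.2 = 1 by rewrite /g entryE.
  have p2e : (p.2 <= e p.1)%N.
    by apply: stair_max gp => //; rewrite leqnn.
  have boxE r c : (p.1 <= r <= a)%N -> (p.2 <= c <= b)%N -> g r c = 1 ->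
      r = p.1 /\ c = p.2.
    move=> rp cp grc.
    have rn : (r < n)%N by case/andP: rp => _ ra; exact: leq_ltn_trans ra _.
    have cn : (c < n)%N by case/andP: cp => _ cb; exact: leq_ltn_trans cb _.
    have := box (Ordinal rn, Ordinal cn); rewrite /in_box /= rp cp /=.
    rewrite -entryE /= -/(g r c) grc /= => /orP[/eqP<-//|].
    rewrite xpair_eqE -!val_eqE /= => /andP[/eqP rE /eqP cE].
    by move: grc; rewrite rE cE gab.
  have [r rp gr] := stair_mem grow gab pa.
  have [|_ eE] := boxE _ _ rp _ gr; first by rewrite p2e stair_le.
  rewrite -/e in eE; rewrite eE eqxx; split=> //.
  have [pa'|ap] := ltnP p.1 a; last first.
    have pE : p.1 = a by apply/val_inj/eqP; rewrite eqn_leq pa.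
    rewrite /e stair_gt //.
    apply: contra_neq pab => pbE.
    by rewrite [p]surjective_pairing pE (val_inj pbE).
  apply/eqP => pe; have [r' rp' gr'] := stair_mem grow gab pa'.
  rewrite -/e -pe in gr'.
  by have [||rE _] := boxE r' p.2 _ _ gr'; [lia | rewrite leqnn pb | lia].
case=> /eqP pe ne; have [pa gp lt] := stair_drop grow gab ne.
have pb : (p.2 <= b)%N by rewrite pe; exact: stair_le.
rewrite -/e -pe in gp lt.
apply/and5P; split=> //.
- by apply/eqP => pab; move: gp; rewrite pab /= gab.
- by rewrite -entryE -/g gp.
apply/forallP => -[r c]; apply/implyP; rewrite /in_box /= => /andP[].
case/andP=> rp cp; rewrite -entryE -/(g r c) => nz.
have [gneg|gpos] := ltrP (g r c) 0.
  apply/orP; right; rewrite xpair_eqE -!val_eqE /=.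
  by move: (gfirst gneg) rp cp; lia.
have grc : g r c = 1 by have := g_le1 grow r c; lia.
have cb : (c <= b)%N by lia.
have cE : c = p.2 :> nat.
  by have := stair_max rp cb grc; rewrite -/e -pe; lia.
have [rE|rne] := eqVneq (r : nat) p.1.
  apply/orP; left; rewrite [p]surjective_pairing.
  by rewrite (val_inj rE) (val_inj cE).
have rp' : (p.1 < r <= a)%N by lia.
have pa' : (p.1 < a)%N by lia.
have := stair_max rp' cb grc; rewrite -/e.
by have := lt pa'; lia.
Qed.

Lemma stair_ltn i : (e i < n)%N.
Proof. exact: leq_ltn_trans (stair_le _ _ _ _) (ltn_ord b). Qed.

Lemma mem_pivots (p : 'I_n * 'I_n) :
  (p \in pivots A a b) = (p.2 == e p.1 :> nat) && (e p.1 != e p.1.+1).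
Proof. by rewrite mem_sort mem_enum -is_pivotE. Qed.

Lemma pivots_rows :
  [seq val p.1 | p <- pivots A a b] = [seq i <- iota 0 a.+1 | e i != e i.+1].
Proof.
apply: (irr_sorted_eq ltn_trans ltnn).
- rewrite ltn_sorted_uniq_leq; apply/andP; split.
    rewrite map_inj_in_uniq ?sort_uniq ?enum_uniq // => -[p1 p2] [q1 q2].
    rewrite !mem_pivots /= => /andP[/eqP p2E _] /andP[/eqP q2E _] pq.
    by congr (_, _); apply: val_inj => //=; rewrite p2E q2E pq.
  by rewrite sorted_map; apply: sort_sorted => p q; exact: leq_total.
- by apply: sorted_filter (iota_ltn_sorted _ _); exact: ltn_trans.
move=> i; rewrite mem_filter mem_iota; apply/mapP/andP.
  case=> p; rewrite mem_pivots => /andP[_ ne] ->; split=> //.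
  by have [] := stair_drop grow gab ne.
case=> ne /andP[_ ia]; have il : (i < n)%N by have := ltn_ord a; lia.
by exists (Ordinal il, Ordinal (stair_ltn i)); rewrite //= mem_pivots /= eqxx.
Qed.

(** Row [a] always holds the last pivot, since [e a < b], and so gives no corner. *)
Lemma mem_corners (c : 'I_n * 'I_n) : (c \in corners (pivots A a b)) =
  [&& (c.1 < a)%N, e c.1 != e c.1.+1 & c.2 == e c.1.+1 :> nat].
Proof.
have inj : injective (fun c : 'I_n * 'I_n => (val c.1, val c.2)).
  by move=> [? ?] [? ?] [/val_inj-> /val_inj->].
rewrite -(mem_map inj) (@corners_rows _ e) => [|p]; last first.
  by rewrite mem_pivots => /andP[/eqP].
have ea : e (0 + a) != e (0 + a).+1.
  by rewrite add0n /e [stair g a b a.+1]stair_gt // neq_ltn stair_a.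
rewrite pivots_rows (consecutive_drops ea).2.
apply/mapP/and3P => [[i]|[ca ne /eqP cE]].
  by rewrite mem_filter mem_iota => /andP[ne /andP[_ ia]] [-> ->].
by exists (val c.1); rewrite ?mem_filter ?mem_iota ?ne //= cE.
Qed.

Lemma first_neg_removable : removable A a b.
Proof.
rewrite /removable -entryE -/g gab eqxx; apply/allP => c _.
apply/forallP => -[i j]; apply/implyP; rewrite -entryE -/(g i j) /in_box /=.
case/andP=> /andP[ci cj] /gfirst; rewrite xpair_eqE -!val_eqE /=.
by move: ci cj; lia.
Qed.

Lemma entry_inflate i j : entry (inflate A a b) i j = inflated g a b i j.
Proof.
rewrite inflatedE -/e.
have [|ij] := boolP ((i < n) && (j < n))%N; last first.
  rewrite negb_and -!leqNgt in ij; rewrite /g !entry_out // add0r.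
  have := stair_ltn i; have := stair_ltn i.+1; have := ltn_ord a.
  case/orP: ij => [ni|nj]; last lia.
  have ia := leq_trans (ltn_ord a) ni.
  by rewrite /e !stair_gt ?subrr // ltnW.
case/andP=> ilt jlt; pose i' := Ordinal ilt; pose j' := Ordinal jlt.
rewrite -[i]/(val i') -[j]/(val j') /g !entryE mxE mem_corners mem_pivots.
rewrite -!entryE -/g -pair_eqE /pair_eq -!val_eqE /=.
have [eqe|ne] := eqVneq (e i) (e i.+1).
  have ia : i != a.
    apply: contra_eqN eqe => /eqP->; rewrite /e [stair g a b a.+1]stair_gt //.
    by rewrite neq_ltn stair_a.
  by rewrite eqe subrr addr0 !andbF (negPf ia).
have [ia gi lt] := stair_drop grow gab ne; rewrite -/e in gi lt.
rewrite andbT; have [ca|ac] := ltnP i a; rewrite /=.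
  have {}lt := lt ca.
  have [jd|jd] := eqVneq j (e i.+1).
    (* The only 1 of the row is in column [e i], so the corner replaces a 0 and writing 1 agrees
       with adding 1. *)
    rewrite jd; have -> : g i (e i.+1) = 0.
      apply: (@unit_sums_unique (g i) n (e i)); rewrite ?stair_ltn //.
        by move=> k _; apply: (g_ge0 gab gfirst); rewrite ca.
      by rewrite neq_ltn lt.
    lia.
  have [jc|jc] := eqVneq j (e i).
    by rewrite orbT jc gi; lia.
  by rewrite orbF subrr addr0; case: ifP => //; lia.
have iE : i = a by lia.
have eb : e i.+1 = b by rewrite /e stair_gt // iE.
have [jc|jc] := eqVneq j (e i).
  by rewrite orbT jc gi eb; rewrite eb in ne; lia.
rewrite eb iE eqxx orbF; have [jb|jb] := eqVneq j b; last by rewrite addr0.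
by rewrite jb gab.
Qed.

End Inflate.

(** * Inflation steps and the induction on negative entries *)

Section InflateAsm.
Variables (n : nat) (A : asm n) (a b : 'I_n).
Hypothesis first_ab : is_first_neg A (a, b).

Let gab := first_neg_entry first_ab.
Let gfirst := entry_first_neg first_ab.

Lemma inflate_is_asm : is_asm (inflate A a b).
Proof.
have [row01 col01 row1 col1] := (is_asmP A).1 (asmP A).
have rowE i p : psum (entry (inflate A a b) i) p =
    psum (inflated (entry A) a b i) p.
  by apply: eq_psum => k _; exact: entry_inflate.
have colE j p : psum (entry (inflate A a b) ^~ j) p =
    psum (inflated (entry A) a b ^~ j) p.
  by apply: eq_psum => k _; exact: entry_inflate.
have e_lt i : (stair (entry A) a b i < n)%N by exact: stair_ltn.
apply/is_asmP; split=> [i p|j p|i il|j jl]; rewrite ?rowE ?colE.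
- exact: inflated_row_unit.
- exact: inflated_col_unit.
- by rewrite psum_inflated_row row1 // !e_lt.
(* The telescoped change ends at [stair n = b], because [a < n], and is zero. *)
- by rewrite psum_inflated_col // col1 // stair_gt // subrr addr0.
Qed.

Lemma card_neg_inflate :
  #|[set p : 'I_n * 'I_n | A p.1 p.2 < 0]| =
  #|[set p : 'I_n * 'I_n | inflate A a b p.1 p.2 < 0]|.+1.
Proof.
rewrite (cardsD1 (a, b)) inE /= -entryE gab add1n; congr _.+1; apply: eq_card.
have [row01 _ _ _] := (is_asmP A).1 (asmP A).
move=> -[i j]; rewrite !inE /= -!entryE entry_inflate // inflated_lt0 //.
by rewrite andbC xpair_eqE negb_and.
Qed.

Lemma inflate_firstE : inflate_first A = inflate A a b.
Proof.
rewrite /inflate_first; case: pickP => [[a' b'] first_ab'|/(_ (a, b))].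
  have [-> ->] : a' = a /\ b' = b.
    have := entry_first_neg first_ab (i := a') (j := b').
    have := entry_first_neg first_ab' (i := a) (j := b).
    rewrite (first_neg_entry first_ab') gab => /(_ isT) h /(_ isT) h'.
    by split; apply: val_inj => /=; lia.
  by rewrite first_neg_removable.
by rewrite first_ab.
Qed.

End InflateAsm.

Lemma first_neg_exists n (A : asm n) p : A p.1 p.2 < 0 ->
  exists q, is_first_neg A q.
Proof.
(* [h] is the rank in reading order: columns are below [n], so minimising it minimises the row first
   and then the column. *)
move=> Ap; pose h (q : 'I_n * 'I_n) := (q.1 * n + q.2)%N.
case: (@arg_minnP _ p (fun q => A q.1 q.2 < 0) h Ap) => q Aq qmin.
exists q; apply/andP; split.
  have [row01 _ _ _] := (is_asmP A).1 (asmP A).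
  by move: Aq (unit_sums_range q.2 (row01 q.1)); rewrite -entryE; clear; lia.
apply/forallP => r; apply/implyP => /qmin; rewrite /h -val_eqE /= => hqr.
case: (ltngtP q.1 r.1) => //= [lt|E]; last by rewrite E leq_add2l in hqr.
have := leq_mul lt (leqnn n); rewrite mulSn; move: hqr (ltn_ord r.2).
by move: (q.1 * n)%N (r.1 * n)%N (val q.2) (val r.2) => u v w z; lia.
Qed.

(* Without negative entries the pipe leaving column [j] keeps its label [j]:
   every crossing is met from the left by a smaller label. *)
Lemma demazure_perm n (A : asm n) : (forall i j, 0 <= A i j) ->
  perm_mx (demazure (Phi A)) = A.
Proof.
move=> A_ge0; have [row01 _ _ _] := (is_asmP A).1 (asmP A).
have neg1 i j : entry A i j != -1.
  rewrite /entry; case: insub => // i'; case: insub => // j'.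
  by apply: contraTneq (A_ge0 i' j') => ->.
(* A label carried along the row entered it at a 1 in its own column, so it is smaller than the
   later columns and wins every crossing to the right. *)
have run_lt i (v : nat -> option 'I_n) k (x : 'I_n) : (k <= n)%N ->
    (forall (j x : 'I_n), v j = Some x -> x = j) ->
    run (entry A i) v k = Some x -> (x < k)%N /\ entry A i x = 1.
  move=> kn vE; elim: k kn x => //= k IHk kn x.
  have v_k z : v k = Some z -> z = k :> nat by move/(vE (Ordinal kn) z)->.
  rewrite /step (negPf (neg1 _ _)); case: eqP => [Aik /v_k-> //|_].
  rewrite /cross; case rE: (run _ _ _) => [z|//].
  have [zk Az] := IHk (ltnW kn) z rE.
  case: (v k) v_k => [y /(_ y erefl) yE|_].
    by rewrite /= yE (ltnW zk) => -[<-]; rewrite ltnS ltnW.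
  by case=> <-; rewrite ltnS ltnW.
have labelsE m (i : 'I_n) : (m + i.+1 = n)%N ->
    forall j x : 'I_n, up_label (Phi_tile A) m j = Some x -> x = j.
  elim: m i => [|m IHm] i mi j x /=; first by rewrite valK => -[].
  have i1n : (i.+1 < n)%N by lia.
  pose i1 := Ordinal i1n; have mi1 : (m + i1.+1 = n)%N by rewrite /=; lia.
  rewrite -/(up_label (Phi_tile A) m.+1 j) (labelsS A j mi1) /out /step.
  rewrite (negPf (neg1 _ _)); case: ifP => // _.
  have v_j z : up_label (Phi_tile A) m j = Some z -> z = j.
    exact: IHm mi1 _ _.
  rewrite /cross; case rE: (run _ _ _) => [z|] /=; last exact: v_j.
  have [zj _] := run_lt _ _ _ _ (ltnW (ltn_ord j)) (IHm _ mi1) rE.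
  case: (up_label _ m j) v_j => // y /(_ y erefl) -> /=.
  by rewrite (ltnW zj) => -[].
apply/matrixP => i j; rewrite !mxE -(entryE A).
have A1 : entry A i (demazure (Phi A) i) = 1.
  have mi : (n - i.+1 + i.+1 = n)%N by rewrite subnK.
  have := demazureE (Phi A) i; rewrite exit_run.
  by case/(run_lt _ _ _ _ (leqnn n) (labelsE _ _ mi)).
have [<-|ne] := eqVneq (demazure (Phi A) i) j; first by rewrite A1.
rewrite (@unit_sums_unique (entry A i) n (demazure (Phi A) i)) //.
  by move=> k kn; rewrite (entryE A i (Ordinal kn)) A_ge0.
by rewrite eq_sym val_eqE.
Qed.

Theorem theorem4p3 (n : nat) (A : asm n) :
  perm_mx (demazure (Phi A)) = asm_key A.
Proof.
rewrite /asm_key; have [k kE] : exists k, #|[set p | A p.1 p.2 < 0]| = k.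
  by eexists.
(* The number of negative entries is both the iteration count and the induction measure, so each
   inflation uses up one iteration. *)
rewrite kE; elim: k A kE => [|k IHk] A.
  move/eqP; rewrite cards_eq0 => /eqP A0; apply: demazure_perm => i j.
  by rewrite leNgt; have /setP/(_ (i, j)) := A0; rewrite !inE /= => ->.
move=> cardA; have [p pP] : exists p, p \in [set p | A p.1 p.2 < 0].
  by apply/card_gt0P; rewrite cardA.
rewrite inE in pP; have [[a b] first_ab] := first_neg_exists pP.
pose A' := ASM (inflate_is_asm first_ab).
rewrite iterSr (inflate_firstE first_ab) -[inflate A a b]/(asm_mx A') -IHk.
  congr perm_mx; apply: (demazure_inflated (first_neg_entry first_ab)).
    exact: entry_first_neg.
  by move=> i j; exact: entry_inflate.
by apply: succn_inj; rewrite -cardA (card_neg_inflate first_ab).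
Qed.
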